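(* Let $K$ be a field and $T\in K^{n\times n\times 4}$ a tensor of rank $r$ with slices $A_1,A_2,A_3,A_4$. Assume $A_1$ is invertible and let $A'_k=A_1^{-1}A_k$ for $k=2,3,4$. Then $\dim\big(\mathrm{Im}[A'_2,A'_3]+\mathrm{Im}[A'_2,A'_4]\big)\leq 3(r-n)$.
   Context: Tensor rank: least number of tensors $u\otimes v\otimes w$ (entries $u_iv_jw_k$) summing to $T$. Slices: $A_k=(T_{ijk})_{i,j}$. $[X,Y]=XY-YX$; $\mathrm{Im}$ is the column space. *)

(* Defs.v *)
From mathcomp Require Import all_boot all_order all_algebra.

Set Implicit Arguments.
Unset Strict Implicit.
Unset Printing Implicit Defensive.

Import GRing.Theory.
Local Open Scope ring_scope.

Definition tensor (K : Type) (m n p : nat) := 'I_m -> 'I_n -> 'I_p -> K.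

Section Tensor.
Variables (K : fieldType) (m n p : nat).
Implicit Type T : tensor K m n p.

Definition slice T (k : 'I_p) : 'M[K]_(m, n) := \matrix_(i, j) T i j k.

Definition pure_tensor (u : 'cV[K]_m) (v : 'cV[K]_n) (w : 'cV[K]_p) :
    tensor K m n p :=
  fun i j k => u i 0 * v j 0 * w k 0.

Definition sum_of_pure_tensors T (r : nat) : Prop :=
  exists (u : 'I_r -> 'cV[K]_m) (v : 'I_r -> 'cV[K]_n) (w : 'I_r -> 'cV[K]_p),
    forall i j k, T i j k = \sum_(l < r) pure_tensor (u l) (v l) (w l) i j k.

Definition has_tensor_rank T (r : nat) : Prop :=
  sum_of_pure_tensors T r /\
  forall s : nat, sum_of_pure_tensors T s -> (r <= s)%N.

End Tensor.

Definition commutator_mx (K : fieldType) (n : nat) (X Y : 'M[K]_n) : 'M[K]_n :=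
  X *m Y - Y *m X.

(* The column space, as the image of v |-> X *m v on column vectors; note that
   the %MS notions of mxalgebra are about row spaces instead. *)
Definition colspace (K : fieldType) (m n : nat) (X : 'M[K]_(m, n)) :
    {vspace 'cV[K]_m} :=
  limg (linfun (mulmx X : 'cV[K]_n -> 'cV[K]_m)).

(* Main.v *)
Require Import Defs.
From mathcomp Require Import all_boot all_order all_algebra.

Set Implicit Arguments.
Unset Strict Implicit.
Unset Printing Implicit Defensive.

Import GRing.Theory.
Local Open Scope ring_scope.

(** Write [A_k = U D_k V] with [D_k] diagonal of size [r].  If [D_1] is
    invertible, then after rescaling [A'_k = P D_k V] with [P V = 1], and
    [Q = 1 - V P] has rank [r - n].  As the [D_k] commute,
    [[A'_2, A'_k] = P D_k Q D_2 V - P D_2 Q D_k V], so the two images lie in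
    [Im (P D_2 Q) + Im (P D_3 Q) + Im (P D_4 Q)].  In general, replace [D_1] by
    [D_1 + t], which is invertible over [K(t)]; once the inverse of
    [A_1 + t U V] is replaced by its adjugate all matrices are polynomial in
    [t], and the rank cannot increase on specializing to [t = 0]. *)

(** Both column spaces lie in that of [col_base R], a matrix with only [\rank R] columns. *)
Lemma dim_colspaceD (K : fieldType) m n p (X : 'M[K]_(m, n)) (Y : 'M_(m, p)) :
  (\dim (colspace X + colspace Y)%VS <= \rank (row_mx X Y))%N.
Proof.
set R := row_mx X Y.
have colspaceM q (Z : 'M[K]_(m, q)) B : Z = col_base R *m B ->
  (colspace Z <= colspace (col_base R))%VS.
  move=> ->; apply/subvP => _ /memv_imgP[x _ ->].
  by rewrite lfunE /= -mulmxA; apply/memv_imgP; exists (B *m x); rewrite ?memvf ?lfunE.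
have eqR : row_mx X Y = col_base R *m row_base R by rewrite mulmx_base.
have sXY : (colspace X + colspace Y <= colspace (col_base R))%VS.
  rewrite subv_add; apply/andP; split.
    by apply: (@colspaceM _ _ (lsubmx (row_base R))); rewrite mulmx_lsub -eqR row_mxKl.
  by apply: (@colspaceM _ _ (rsubmx (row_base R))); rewrite mulmx_rsub -eqR row_mxKr.
apply: leq_trans (dimvS sXY) _.
have := limg_ker_dim (linfun (mulmx (col_base R) : 'cV_(\rank R) -> _)) fullv.
by rewrite dimvf /dim /= muln1 => rkE; rewrite -[leqRHS]rkE leq_addl.
Qed.

(** Since [P *m V = 1], [Q *m V = 0] and [V] has rank [n], so [\rank Q <= r - n]. Both commutators
    factor on the left through the three blocks [P *m Dk *m Q], each of rank at most [\rank Q]. *)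
Lemma rank_commutators_compression (F : fieldType) n r
    (P : 'M[F]_(n, r)) (V : 'M_(r, n)) (D2 D3 D4 : 'M_r)
    (X2 := P *m D2 *m V) (X3 := P *m D3 *m V) (X4 := P *m D4 *m V) :
  P *m V = 1%:M -> comm_mx D2 D3 -> comm_mx D2 D4 ->
  (\rank (row_mx (commutator_mx X2 X3) (commutator_mx X2 X4)) + 3 * n
     <= 3 * r)%N.
Proof.
move=> PV D23 D24.
pose Q := 1%:M - V *m P.
have rkV : \rank V = n by apply/eqP/row_fullP; exists P.
have rkQ : (\rank Q + n <= r)%N.
  rewrite -{1}rkV; apply: mulmx0_rank_max.
  by rewrite mulmxBl mul1mx -mulmxA PV mulmx1 subrr.
have rkPQ D : (\rank (P *m D *m Q) <= \rank Q)%N by exact: mxrankM_maxr.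
(* Substituting [V *m P = 1 - Q] in both products leaves the terms [P *m D2 *m D *m V] and
   [P *m D *m D2 *m V], which cancel because [D2] and [D] commute. *)
have commE D : comm_mx D2 D ->
  commutator_mx X2 (P *m D *m V) =
    P *m D *m Q *m (D2 *m V) - P *m D2 *m Q *m (D *m V).
  move=> DC; rewrite /commutator_mx /X2 /Q !(mulmxBr, mulmxBl) !mulmx1 !mulmxA.
  rewrite -(mulmxA P D D2) -DC -(mulmxA P D2 D) !mulmxA.
  by rewrite opprB [RHS]addrC addrA subrK.
pose B := row_mx (row_mx (P *m D2 *m Q) (P *m D3 *m Q)) (P *m D4 *m Q).
have -> : row_mx (commutator_mx X2 X3) (commutator_mx X2 X4) =
  B *m row_mx (col_mx (col_mx (- (D3 *m V)) (D2 *m V)) 0)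
              (col_mx (col_mx (- (D4 *m V)) 0) (D2 *m V)).
  rewrite mul_mx_row /B !mul_row_col !mulmx0 !addr0 !mulmxN !commE //.
  by rewrite [X in row_mx X _]addrC [X in row_mx _ X]addrC.
have rkB : (\rank B <= 3 * \rank Q)%N.
  rewrite -mxrank_tr /B !tr_row_mx -addsmxE.
  apply: leq_trans (mxrank_adds_leqif _ _) _.
  rewrite -addsmxE mulSn addnC leq_add //; first by rewrite mxrank_tr.
  apply: leq_trans (mxrank_adds_leqif _ _) _.
  by rewrite !mxrank_tr mul2n -addnn leq_add.
apply: leq_trans (leq_add (leq_trans (mxrankM_maxl _ _) rkB) (leqnn _)) _.
by rewrite -mulnDr leq_mul2l.
Qed.

(** Absorbing [diag_mx d1] into [V] and [invmx (A d1)] into [U] gives factors with product 1; the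
    diagonals become the quotients [d / d1]. *)
Lemma rank_commutators_diag (F : fieldType) n r
    (U : 'M[F]_(n, r)) (V : 'M_(r, n)) (d1 d2 d3 d4 : 'rV_r) :
  let A d := U *m diag_mx d *m V in
  let A' d := invmx (A d1) *m A d in
  (forall l, d1 0 l != 0) -> A d1 \in unitmx ->
  (\rank (row_mx (commutator_mx (A' d2) (A' d3)) (commutator_mx (A' d2) (A' d4)))
     + 3 * n <= 3 * r)%N.
Proof.
move=> A A' d1_neq0 A1unit.
pose e (d : 'rV[F]_r) : 'rV[F]_r := \row_l (d 0 l / d1 0 l).
have A'E d : A' d = invmx (A d1) *m U *m diag_mx (e d) *m (diag_mx d1 *m V).
  rewrite /A' {2}/A !mulmxA; congr (_ *m _).
  rewrite -!mulmxA; congr (_ *m (_ *m _)); rewrite mulmx_diag; congr diag_mx.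
  by apply/rowP => l; rewrite !mxE divfK.
rewrite !A'E; apply: rank_commutators_compression.
- by rewrite -mulmxA [U *m _]mulmxA mulVmx.
- exact: diag_mxC.
- exact: diag_mxC.
Qed.

Lemma map_polyC_mxK (R : comNzRingType) m n (a : R) :
  cancel (@map_mx _ _ polyC m n) (map_mx (horner_eval a)).
Proof. by move=> A; apply/matrixP => i j; rewrite !mxE /horner_eval hornerC. Qed.

(** Constant matrices [L] and [R] cut out of [M] a square matrix [N] of size [\rank M0] that
    specializes to the identity. Hence [\det N] is a nonzero polynomial and [N] is invertible over
    the fraction field. *)
Lemma rank_specialize (K : fieldType) m n (a : K) (M : 'M[{poly K}]_(m, n)) :
  (\rank (map_mx (horner_eval a) M) <= \rank (map_mx (@tofrac {poly K}) M))%N.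
Proof.
set M0 := map_mx (horner_eval a) M.
have /row_fullP[L LC] := col_base_full M0.
have /row_freeP[R BR] := row_base_free M0.
pose N := map_mx polyC L *m M *m map_mx polyC R.
have N0 : map_mx (horner_eval a) N = 1%:M.
  have LM0 : L *m M0 = row_base M0.
    by have := congr1 (mulmx L) (mulmx_base M0); rewrite mulmxA LC mul1mx => <-.
  by rewrite !map_mxM !map_polyC_mxK LM0 BR.
have detN : \det N != 0.
  apply: contra_eq_neq (congr1 determinant N0) => /eqP detN0.
  by rewrite det_map_mx (eqP detN0) rmorph0 det1 eq_sym oner_neq0.
have /mxrank_unit <- : map_mx (@tofrac {poly K}) N \in unitmx.
  by rewrite unitmxE det_map_mx unitfE tofrac_eq0.
rewrite !map_mxM; apply: leq_trans (mxrankM_maxl _ _) _.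
exact: mxrankM_maxr.
Qed.

(** The adjugate, unlike the inverse, is polynomial in the entries, so this matrix is compatible
    with all ring morphisms. *)
Definition adj_commutators (R : comNzRingType) n (A1 A2 A3 A4 : 'M[R]_n) :=
  let B A := \adj A1 *m A in
  row_mx (B A2 *m B A3 - B A3 *m B A2) (B A2 *m B A4 - B A4 *m B A2).

Lemma map_adj_commutators (R S : comNzRingType) (f : {rmorphism R -> S}) n
    (A1 A2 A3 A4 : 'M[R]_n) :
  map_mx f (adj_commutators A1 A2 A3 A4) =
  adj_commutators (map_mx f A1) (map_mx f A2) (map_mx f A3) (map_mx f A4).
Proof. by rewrite map_row_mx !map_mxB !map_mxM map_mx_adj. Qed.

Lemma rank_adj_commutators (F : fieldType) n (A1 A2 A3 A4 : 'M[F]_n) :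
  A1 \in unitmx ->
  let A' A := invmx A1 *m A in
  \rank (adj_commutators A1 A2 A3 A4) =
  \rank (row_mx (commutator_mx (A' A2) (A' A3)) (commutator_mx (A' A2) (A' A4))).
Proof.
move=> A1u A'.
have det0 : \det A1 != 0 by rewrite -unitfE -unitmxE.
have adjE A : \adj A1 *m A = \det A1 *: A' A.
  by rewrite /A' /invmx A1u -scalemxAl scalerA divff // scale1r.
rewrite /adj_commutators !adjE -!scalemxAl -!scalemxAr -!scalerBr -!scale_row_mx.
by rewrite !(eqmx_scale _ det0).
Qed.

(* The slices A_1, ..., A_4 are those at the indices 0, ..., 3 of 'I_4; the
   inequality is in int, so that r - n is not truncated. *)
Theorem theorem3p8 (K : fieldType) (n r : nat) (T : tensor K n n 4)
    (A1 := slice T 0) (A2 := slice T 1) (A3 := slice T 2) (A4 := slice T 3)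
    (A2' := invmx A1 *m A2) (A3' := invmx A1 *m A3) (A4' := invmx A1 *m A4) :
  has_tensor_rank T r ->
  A1 \in unitmx ->
  ((\dim (colspace (commutator_mx A2' A3') +
          colspace (commutator_mx A2' A4'))%VS)%:Z
    <= 3%:Z * (r%:Z - n%:Z))%R.
Proof.
move=> [[u [v [w Tuvw]]] _] A1u.
suff: (\rank (row_mx (commutator_mx A2' A3') (commutator_mx A2' A4')) + 3 * n
         <= 3 * r)%N.
  move=> /(leq_trans (leq_add (dim_colspaceD _ _) (leqnn _))).
  by rewrite mulrBr Num.Theory.lerBrDr -!PoszM -PoszD lez_nat.
pose U : 'M[K]_(n, r) := \matrix_(i, l) u l i 0.
pose V : 'M[K]_(r, n) := \matrix_(l, j) v l j 0.
pose d k : 'rV[K]_r := \row_l w l k 0.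
have sliceE k : slice T k = U *m diag_mx (d k) *m V.
  apply/matrixP => i j; rewrite !mxE Tuvw; apply: eq_bigr => l _.
  by rewrite mul_mx_diag !mxE /pure_tensor mulrAC.
rewrite -rank_adj_commutators //.
(* Adding ['X] times [U *m V] to [A1] amounts to adding ['X] to each diagonal entry of
   [diag_mx (d 0)]. *)
pose A1t : 'M[{poly K}]_n := map_mx polyC A1 + 'X *: map_mx polyC (U *m V).
pose M := adj_commutators A1t (map_mx polyC A2) (map_mx polyC A3) (map_mx polyC A4).
have A1t0 : map_mx (horner_eval 0) A1t = A1.
  by rewrite map_mxD map_mxZ !map_polyC_mxK /= /horner_eval hornerX scale0r addr0.
have <- : map_mx (horner_eval 0) M = adj_commutators A1 A2 A3 A4.
  by rewrite map_adj_commutators !map_polyC_mxK A1t0.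
apply: leq_trans (leq_add (rank_specialize _ _) (leqnn _)) _.
pose iota := @tofrac {poly K} \o polyC.
pose t := tofrac ('X : {poly K}).
pose d1t := map_mx iota (d 0) + const_mx t.
have fracE k : map_mx (@tofrac _) (map_mx polyC (slice T k)) =
    map_mx iota U *m diag_mx (map_mx iota (d k)) *m map_mx iota V.
  by rewrite -map_mx_comp sliceE !map_mxM map_diag_mx.
have fracA1t : map_mx (@tofrac _) A1t = map_mx iota U *m diag_mx d1t *m map_mx iota V.
  rewrite map_mxD map_mxZ fracE -map_mx_comp map_mxM /d1t raddfD /=.
  by rewrite diag_const_mx mulmxDr mulmxDl mul_mx_scalar -scalemxAl.
(* The determinant of [A1t] takes the nonzero value [\det A1] at 0. *)
have A1tu : map_mx (@tofrac _) A1t \in unitmx.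
  rewrite unitmxE det_map_mx unitfE tofrac_eq0.
  apply: contraTneq A1u => det0.
  by rewrite -A1t0 unitmxE det_map_mx det0 rmorph0 unitr0.
rewrite map_adj_commutators rank_adj_commutators // !fracE fracA1t.
apply: rank_commutators_diag; last by rewrite -fracA1t.
(* Each entry of [d1t] is the image of ['X] plus a constant, a polynomial of size 2. *)
move=> l; rewrite !mxE /= -tofracD tofrac_eq0 -size_poly_eq0.
by rewrite addrC size_XaddC.
Qed.
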